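(* Let $f,g,h,L,\gamma$ satisfy the assumptions in the context, let $\varphi(x)=f(x)+g(x)+h(Lx)$ on $\mathbb{R}^n$, and let $\varphi^\gamma$ be the envelope defined in the context. Then 1. $\inf_{x\in \mathbb{R}^n}\varphi(x)=\inf_{z\in\mathbb{R}^n}\varphi^{\gamma}(z)$; 2. $\arg\min_{x\in\mathbb{R}^n}\varphi(x)=P_{\gamma g}\big(\arg\min_{z\in\mathbb{R}^n}\varphi^{\gamma}(z)\big)$ (the image of the set of minimizers of $\varphi^\gamma$ under $P_{\gamma g}$).
   Context: Notation. For $\xi:\mathbb{R}^n\to\mathbb{R}\cup\{\infty\}$ and $\gamma>0$: $P_{\gamma \xi}(z)=\arg\min_{u\in\mathbb{R}^n}\{\xi(u)+\frac{1}{2\gamma}\|u-z\|^2\}$ is the proximal mapping and $\xi^{\gamma}(z)=\inf_{u\in\mathbb{R}^n}\{\xi(u)+\frac{1}{2\gamma}\|z-u\|^2\}$ is the Moreau envelope. ''$M$-Lipschitz differentiable'' means differentiable with $M$-Lipschitz gradient. $\|\cdot\|$ is the Euclidean norm (operator norm for $L$), and $1/0=+\infty$. Assumptions. $L:\mathbb{R}^n\to\mathbb{R}^m$ is linear; $g:\mathbb{R}^n\to\mathbb{R}$ is $L_g$-Lipschitz differentiable; $h:\mathbb{R}^m\to\mathbb{R}$ is $L_h$-Lipschitz differentiable; $f:\mathbb{R}^n\to\mathbb{R}\cup\{\infty\}$ is proper and lower semicontinuous; $\gamma\in(0,\frac{1}{L_g+L_h\|L\|^2})$; and $f+\frac{1}{2\gamma'}\|\cdot\|^2$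 is bounded below for every $\gamma'\in(0,\frac{1}{L_g+L_h\|L\|^2})$. (No convexity is assumed; $P_{\gamma g}$ is single-valued and $g^\gamma$ is differentiable under these assumptions.) Envelope. With $q(z)=L^T\nabla h\big(LP_{\gamma g}(z)\big)$, $$\varphi^{\gamma}(z) = g^{\gamma}(z)-\gamma \|\nabla g^{\gamma}(z)\|^2-\gamma \langle q(z), \nabla g^{\gamma}(z)\rangle +h\big(LP_{\gamma g}(z)\big)-\frac{\gamma}{2}\|q(z)\|^2 +f^{\gamma}\big(z-2\gamma \nabla g^{\gamma}(z)-\gamma q(z)\big).$$ *)

(* Defs.v *)
From HB Require Import structures.
From mathcomp Require Import all_boot all_order all_algebra.
From mathcomp Require Import all_classical all_reals all_analysis.

Set Implicit Arguments.
Unset Strict Implicit.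
Unset Printing Implicit Defensive.

Import Order.TTheory GRing.Theory Num.Theory.
Import numFieldNormedType.Exports.

Local Open Scope classical_set_scope.
Local Open Scope ring_scope.

Section Euclidean.
Context {R : realType}.

Definition dotv n (x y : 'cV[R]_n) : R := \sum_(i < n) x i 0 * y i 0.

(* The library norm `|x| on 'cV[R]_n is the sup norm: it induces the same
   topology and the same differentials, but not the same Lipschitz moduli nor
   the same operator norm, hence the explicit Euclidean norm. *)
Definition enorm n (x : 'cV[R]_n) : R := Num.sqrt (dotv x x).

Definition opnorm m n (L : 'M[R]_(m, n)) : R :=
  sup [set enorm (L *m x) | x in [set x : 'cV[R]_n | enorm x <= 1]].

Definition grad n (F : 'cV[R]_n -> R) (x : 'cV[R]_n) : 'cV[R]_n :=
  \col_(i < n) 'D_(delta_mx i 0 : 'cV[R]_n) F x.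

Definition lipschitz_differentiable n (M : R) (F : 'cV[R]_n -> R) : Prop :=
  [/\ 0 <= M,
      forall x, differentiable F x
    & forall x y, enorm (grad F x - grad F y) <= M * enorm (x - y)].

End Euclidean.

Section Variational.
Context {R : realType}.
Local Open Scope ereal_scope.

Definition proper_fun T (F : T -> \bar R) : Prop :=
  (forall x, F x != -oo) /\ (exists x, F x != +oo).

Definition argmin T (F : T -> \bar R) : set T :=
  [set x | forall y, F x <= F y].

Definition inf_value T (F : T -> \bar R) : \bar R := ereal_inf (range F).

Definition bounded_below T (F : T -> \bar R) : Prop :=
  exists c : R, forall x, c%:E <= F x.

Definition prox_objective n (gamma : R) (xi : 'cV[R]_n -> \bar R)
    (z u : 'cV[R]_n) : \bar R :=
  xi u + (1 / (2 * gamma) * enorm (u - z) ^+ 2)%:E.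

Definition prox_set n (gamma : R) (xi : 'cV[R]_n -> \bar R) (z : 'cV[R]_n) :
    set 'cV[R]_n :=
  argmin (prox_objective gamma xi z).

(* The element of [prox_set gamma xi z] when this set is a singleton; the
   default value 0 is returned only when the set is empty. *)
Definition prox n (gamma : R) (xi : 'cV[R]_n -> \bar R) (z : 'cV[R]_n) :
    'cV[R]_n :=
  xget 0%R (prox_set gamma xi z).

Definition moreau n (gamma : R) (xi : 'cV[R]_n -> \bar R) (z : 'cV[R]_n) :
    \bar R :=
  inf_value (prox_objective gamma xi z).

(* The extended-real inverse satisfies 0^-1 = +oo. *)
Definition step_bound m n (Lg Lh : R) (L : 'M[R]_(m, n)) : \bar R :=
  ((Lg + Lh * opnorm L ^+ 2)%R%:E)^-1.

End Variational.

Section Envelope.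
Context {R : realType}.
Variables (n m : nat) (f : 'cV[R]_n -> \bar R) (g : 'cV[R]_n -> R).
Variables (h : 'cV[R]_m -> R) (L : 'M[R]_(m, n)) (gamma : R).

Definition objective (x : 'cV[R]_n) : \bar R :=
  (f x + (g x)%:E + (h (L *m x))%:E)%E.

Definition prox_g (z : 'cV[R]_n) : 'cV[R]_n := prox gamma (EFin \o g) z.

Definition moreau_g (z : 'cV[R]_n) : R := fine (moreau gamma (EFin \o g) z).

Definition envelope_q (z : 'cV[R]_n) : 'cV[R]_n :=
  L^T *m grad h (L *m prox_g z).

Definition envelope (z : 'cV[R]_n) : \bar R :=
  ((moreau_g z
    - gamma * enorm (grad moreau_g z) ^+ 2
    - gamma * dotv (envelope_q z) (grad moreau_g z)
    + h (L *m prox_g z)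
    - gamma / 2 * enorm (envelope_q z) ^+ 2)%:E
   + moreau gamma f
       (z - (2 * gamma) *: grad moreau_g z - gamma *: envelope_q z)%R)%E.

End Envelope.

(* Main.v *)
Require Import Defs.
From HB Require Import structures.
From mathcomp Require Import all_boot all_order all_algebra.
From mathcomp Require Import all_classical all_reals all_analysis.
From mathcomp Require Import ring lra.

Import Order.TTheory GRing.Theory Num.Theory.
Import numFieldNormedType.Exports.

Local Open Scope classical_set_scope.
Local Open Scope ring_scope.

(** Write [G x = g x + h (L x)] and [p x = grad g x + L^T grad h (L x)], its
gradient. Since [gamma * Lg < 1], the forward step [x |-> x + gamma grad g x]
is a bijection, with inverse the proximal map of [g] (lemmas
[forward_step_surj] and [prox_g_forward_step]). At [z = x + gamma grad g x] the
Moreau envelope of [g] has value [g x + gamma/2 |grad g x|^2] and gradient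
[grad g x] ([grad_moreau_g_forward_step]). Substituting these values and
completing the square turns the envelope at [z] into the forward-backward
envelope at [x = prox_g z] ([envelope_prox]):
[inf_u (f u + G x + <p x, u - x> + 1/(2 gamma) |u - x|^2)].

The function of [u] under the infimum is a majorization-minimization model of
[phi = f + G]: it equals [phi x] at [u = x], and by the descent lemma it exceeds
[phi u] by at least [c |u - x|^2], with [2c = 1/gamma - (Lg + Lh |L|^2) > 0]
([forward_backward_model_major]). For any such model, [phi] and the function
[x |-> inf_u model x u] have the same infimum ([inf_value_model]) and, when
[phi] is lower semicontinuous and the model infima are not [-oo], the same
minimizers ([argmin_model]): at a minimizer [x] of the latter, points that are
almost optimal in the model are almost optimal for [phi], hence within a small
distance of [x] by the quadratic gap, and lower semicontinuity passes to the
limit.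

Finally, composing with the surjection [prox_g] changes neither the infimum
nor, after taking the image, the set of minimizers. *)

(** * Euclidean geometry of column vectors *)

Section EuclideanSpace.
Set Implicit Arguments.
Unset Strict Implicit.
Context {R : realType}.

Lemma dotvC n (x y : 'cV[R]_n) : dotv x y = dotv y x.
Proof. by apply: eq_bigr => i _; rewrite mulrC. Qed.

Lemma dotvDl n (x y z : 'cV[R]_n) : dotv (x + y) z = dotv x z + dotv y z.
Proof. by rewrite -big_split; apply: eq_bigr => i _; rewrite mxE mulrDl. Qed.

Lemma dotvZl n (a : R) (x y : 'cV[R]_n) : dotv (a *: x) y = a * dotv x y.
Proof. by rewrite mulr_sumr; apply: eq_bigr => i _; rewrite mxE mulrA. Qed.

Lemma dotvNl n (x y : 'cV[R]_n) : dotv (- x) y = - dotv x y.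
Proof. by rewrite -scaleN1r dotvZl mulN1r. Qed.

Lemma dotvDr n (x y z : 'cV[R]_n) : dotv x (y + z) = dotv x y + dotv x z.
Proof. by rewrite dotvC dotvDl !(dotvC x). Qed.

Lemma dotvZr n (a : R) (x y : 'cV[R]_n) : dotv x (a *: y) = a * dotv x y.
Proof. by rewrite dotvC dotvZl dotvC. Qed.

Lemma dotvNr n (x y : 'cV[R]_n) : dotv x (- y) = - dotv x y.
Proof. by rewrite dotvC dotvNl dotvC. Qed.

Definition dotv_lin := (dotvDl, dotvDr, dotvNl, dotvNr, dotvZl, dotvZr).

Lemma dotv0l n (x : 'cV[R]_n) : dotv 0 x = 0.
Proof. by rewrite -(scale0r 0) dotvZl mul0r. Qed.

Lemma dotv_adjoint m n (L : 'M[R]_(m, n)) (p : 'cV[R]_m) (x : 'cV[R]_n) :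
  dotv (L^T *m p) x = dotv p (L *m x).
Proof.
rewrite /dotv.
under eq_bigr do rewrite mxE mulr_suml.
rewrite exchange_big; apply: eq_bigr => i _.
rewrite mxE mulr_sumr; apply: eq_bigr => j _.
by rewrite mxE mulrAC mulrC mulrA.
Qed.

Lemma dotv_ge0 n (x : 'cV[R]_n) : 0 <= dotv x x.
Proof. by apply: sumr_ge0 => i _; rewrite -expr2 sqr_ge0. Qed.

Lemma sqr_coord_le_dotv n (x : 'cV[R]_n) (i : 'I_n) : x i 0 ^+ 2 <= dotv x x.
Proof.
rewrite /dotv (bigD1 i)//= expr2 lerDl.
by apply: sumr_ge0 => j _; rewrite -expr2 sqr_ge0.
Qed.

Lemma dotv_eq0 n (x : 'cV[R]_n) : dotv x x <= 0 -> x = 0.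
Proof.
move=> x0; apply/colP => i; rewrite mxE; apply/eqP.
by rewrite -sqrf_eq0 eq_le sqr_ge0 andbT (le_trans (sqr_coord_le_dotv _ i)).
Qed.

Lemma enorm_ge0 n (x : 'cV[R]_n) : 0 <= enorm x.
Proof. exact: sqrtr_ge0. Qed.

Lemma sqr_enorm n (x : 'cV[R]_n) : enorm x ^+ 2 = dotv x x.
Proof. by rewrite sqr_sqrtr// dotv_ge0. Qed.

Lemma enormZ n (a : R) (x : 'cV[R]_n) : enorm (a *: x) = `|a| * enorm x.
Proof.
by rewrite /enorm dotvZl dotvZr mulrA -expr2 sqrtrM ?sqr_ge0// sqrtr_sqr.
Qed.

Lemma enorm_distC n (x y : 'cV[R]_n) : enorm (x - y) = enorm (y - x).
Proof. by rewrite -opprB -scaleN1r enormZ normrN1 mul1r. Qed.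

(** Cauchy-Schwarz, from the nonnegativity of the squared norm of
[<y, y> x - <x, y> y]. *)
Lemma sqr_dotv_le n (x y : 'cV[R]_n) :
  dotv x y ^+ 2 <= dotv x x * dotv y y.
Proof.
have [y0|y_gt0] := leP (dotv y y) 0.
  by rewrite (dotv_eq0 y0) dotvC !dotv0l mulr0 expr0n.
have := dotv_ge0 (dotv y y *: x - dotv x y *: y).
rewrite !dotv_lin (dotvC y x) => h.
rewrite -subr_ge0 -(pmulr_rge0 _ y_gt0); apply: le_trans h _.
by rewrite le_eqVlt; apply/orP; left; apply/eqP; ring.
Qed.

Lemma dotv_le_enorm n (x y : 'cV[R]_n) : dotv x y <= enorm x * enorm y.
Proof.
have [|xy0] := leP (dotv x y) 0.
  by move=> /le_trans; apply; rewrite mulr_ge0 ?enorm_ge0.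
rewrite -(@ler_pXn2r _ 2) ?nnegrE ?(ltW xy0) ?mulr_ge0 ?enorm_ge0//.
by rewrite exprMn !sqr_enorm sqr_dotv_le.
Qed.

Lemma normr_le_enorm n (x : 'cV[R]_n) : `|x| <= enorm x.
Proof.
rewrite [`|x|]mx_normrE; apply: bigmax_le => [|[i j] _]; first exact: enorm_ge0.
by rewrite (ord1 j)/= -sqrtr_sqr ler_sqrt ?dotv_ge0// sqr_coord_le_dotv.
Qed.

Lemma enorm_le_normr n (x : 'cV[R]_n) : enorm x <= Num.sqrt n%:R * `|x|.
Proof.
rewrite -[`|x|]ger0_norm// -sqrtr_sqr -sqrtrM// ler_sqrt; last first.
  by rewrite mulr_ge0// sqr_ge0.
have -> : n%:R * `|x| ^+ 2 = \sum_(i < n) `|x| ^+ 2.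
  by rewrite sumr_const card_ord mulr_natl.
apply: ler_sum => i _; rewrite -expr2 -real_normK ?num_real//.
rewrite ler_pXn2r ?nnegrE//.
by rewrite [leRHS]mx_normrE (le_bigmax _ _ (i, 0)).
Qed.

(** The topology is defined by the sup norm, which the Euclidean norm
dominates, so every neighbourhood contains a Euclidean ball. *)
Lemma nbhs_enorm_ball n (x : 'cV[R]_n) (V : set 'cV[R]_n) : nbhs x V ->
  exists2 r : R, 0 < r & forall u, dotv (u - x) (u - x) < r -> V u.
Proof.
move=> /nbhs_ballP[e /= e0 eV]; exists (e ^+ 2); first by rewrite exprn_gt0.
move=> u ue; apply: eV; rewrite -ball_normE /=.
rewrite distrC (le_lt_trans (normr_le_enorm _))//.
by rewrite -(@ltr_pXn2r _ 2) ?nnegrE ?enorm_ge0 ?(ltW e0)// sqr_enorm.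
Qed.

(** The supremum defining [opnorm] is that of a bounded set: by Cauchy-Schwarz
on each row, the Frobenius norm is an upper bound. *)
Lemma enorm_mulmx_le m n (L : 'M[R]_(m, n)) (x : 'cV[R]_n) :
  enorm (L *m x) <= opnorm L * enorm x.
Proof.
have [x0|x_gt0] := leP (dotv x x) 0.
  rewrite (dotv_eq0 x0) mulmx0 /enorm dotv0l sqrtr0.
  by rewrite (_ : dotv _ _ = 0) ?dotv0l// sqrtr0 mulr0.
have e0 : 0 < enorm x by rewrite sqrtr_gt0.
rewrite -ler_pdivrMr//.
have -> : enorm (L *m x) / enorm x = enorm (L *m ((enorm x)^-1 *: x)).
  by rewrite -scalemxAr enormZ ger0_norm ?invr_ge0 ?(ltW e0)// mulrC.
apply: ub_le_sup; last first.
  exists ((enorm x)^-1 *: x) => //=.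
  by rewrite enormZ ger0_norm ?invr_ge0 ?(ltW e0)// mulVf// gt_eqF.
exists (Num.sqrt (\sum_i dotv (row i L)^T (row i L)^T)) => _ [y /= y1 <-].
rewrite ler_sqrt; last by apply: sumr_ge0 => i _; exact: dotv_ge0.
apply: ler_sum => i _; rewrite -expr2.
have -> : (L *m y) i 0 = dotv (row i L)^T y.
  by rewrite mxE; apply: eq_bigr => j _; rewrite !mxE.
apply: le_trans (sqr_dotv_le _ _) _.
rewrite ler_piMr ?dotv_ge0// -sqr_enorm expr_le1// enorm_ge0//.
Qed.

Lemma mulmx_continuous m n (L : 'M[R]_(m, n)) :
  continuous (fun x : 'cV[R]_n => L *m x).
Proof.
apply/(@linear_bounded_continuous _ _ _ (mulmx L)); apply/linear_boundedP.
near=> r => x; apply: le_trans (normr_le_enorm _) _.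
apply: le_trans (enorm_mulmx_le _ _) _.
have L0 : 0 <= `|opnorm L| by [].
apply: le_trans (ler_wpM2r (enorm_ge0 _) (ler_norm _)) _.
apply: le_trans (ler_wpM2l L0 (enorm_le_normr _)) _.
rewrite mulrA ler_wpM2r//; near: r; exact: nbhs_pinfty_ge.
Unshelve. all: by end_near. Qed.

(** Complete the square: the minimum is reached at [u = - p / (2 a)]. *)
Lemma quadratic_lb n (a : R) (p u : 'cV[R]_n) : 0 < a ->
  - (dotv p p / (4 * a)) <= a * dotv u u + dotv p u.
Proof.
move=> a0; have := dotv_ge0 (u + (2 * a)^-1 *: p).
rewrite !dotv_lin (dotvC u p) => /(mulr_ge0 (ltW a0)) h.
rewrite -subr_ge0; apply: le_trans h _.
by rewrite le_eqVlt; apply/orP; left; apply/eqP; field; rewrite gt_eqF.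
Qed.

End EuclideanSpace.

(** * Gradients and the descent lemma *)

Section Descent.
Set Implicit Arguments.
Unset Strict Implicit.
Context {R : realType}.

Lemma derive_grad n (F : 'cV[R]_n -> R) (x v : 'cV[R]_n) :
  differentiable F x -> 'D_v F x = dotv (grad F x) v.
Proof.
move=> dF; rewrite deriveE//.
rewrite {1}(matrix_sum_delta v) exchange_big/= big_ord1 linear_sum.
by apply: eq_bigr => i _; rewrite linearZ /= mxE deriveE// mulrC.
Qed.

Lemma is_derive_line n (F : 'cV[R]_n -> R) (x d : 'cV[R]_n) (t : R) :
  differentiable F (x + t *: d) ->
  is_derive t (1 : R) (fun s => F (x + s *: d))
    (dotv (grad F (x + t *: d)) d).
Proof.
move=> dF; rewrite -derive_grad//.
have E : (fun h : R => h^-1 *: (F (x + (h *: 1 + t) *: d) - F (x + t *: d)))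
       = (fun h : R => h^-1 *: (F (h *: d + (x + t *: d)) - F (x + t *: d))).
  apply/funext => h; congr (_ *: (F _ - _)).
  by rewrite [h *: 1]mulr1 scalerDl addrCA.
have dd : derivable F (x + t *: d) d by apply: diff_derivable.
split.
  by rewrite /derivable E.
by rewrite /derive E.
Qed.

(** Along the segment from [x] to [u], the function [psi t], the difference
between [F (x + t d)] and its quadratic upper model, has derivative
[<grad F (x + t d) - grad F x, d> - M t |d|^2], which is nonpositive for
[t >= 0] by Cauchy-Schwarz and the Lipschitz bound. *)
Lemma descent_ub n (M : R) (F : 'cV[R]_n -> R) (x u : 'cV[R]_n) :
  lipschitz_differentiable M F ->
  F u <= F x + dotv (grad F x) (u - x) + M / 2 * dotv (u - x) (u - x).
Proof.
move=> [M0 dF lF]; set d := u - x.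
pose psi (t : R) : R := F (x + t *: d) - dotv (grad F x) d * t
  - M / 2 * dotv d d * t ^+ 2.
have dpsi t : is_derive t (1 : R) psi
    (dotv (grad F (x + t *: d)) d - dotv (grad F x) d - M * dotv d d * t).
  have dl := is_derive_line (dF (x + t *: d)).
  apply: is_derive_eq.
  rewrite /GRing.scale/=; lra.
have : psi 1 <= psi 0.
  apply: (@ler0_derive1_le_cc _ psi 0 1); rewrite ?in_itv/= ?lexx ?ler01//.
  - move=> t; rewrite in_itv/= => /andP[/ltW t0 _].
    rewrite derive1E derive_val -dotvNl -dotvDl.
    rewrite subr_le0 (le_trans (dotv_le_enorm _ _))//.
    apply: le_trans (ler_wpM2r (enorm_ge0 _) (lF _ _)) _.
    rewrite addrAC subrr add0r enormZ ger0_norm// -sqr_enorm.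
    by rewrite le_eqVlt; apply/orP; left; apply/eqP; ring.
  - by apply: derivable_within_continuous => t _; exact: ex_derive.
rewrite /psi scale1r scale0r addr0 mulr1 expr1n mulr1 mulr0 subr0.
rewrite expr0n/= mulr0 subr0 /d (addrC x) subrK => h; lra.
Qed.

Lemma lipschitz_differentiableN n (M : R) (F : 'cV[R]_n -> R) :
  lipschitz_differentiable M F ->
  lipschitz_differentiable M (fun x => - F x)
  /\ forall x, grad (fun x => - F x) x = - grad F x.
Proof.
move=> [M0 dF lF].
have gN x : grad (fun x => - F x) x = - grad F x.
  by apply/colP => i; rewrite !mxE; apply: deriveN; exact: diff_derivable.
split; last exact: gN.
split; first exact: M0.
  by move=> x; exact: differentiableN.
by move=> x y; rewrite !gN opprK addrC enorm_distC.
Qed.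

Lemma descent_lb n (M : R) (F : 'cV[R]_n -> R) (x u : 'cV[R]_n) :
  lipschitz_differentiable M F ->
  F x + dotv (grad F x) (u - x) - M / 2 * dotv (u - x) (u - x) <= F u.
Proof.
move=> /lipschitz_differentiableN[+ gN] => /(descent_ub x u).
rewrite gN dotvNl; lra.
Qed.

(** A quadratic remainder bound identifies the gradient: along each basis vector
the difference quotient at step [h] is within [K |h|] of the claimed
coordinate. *)
Lemma grad_unique_of_quadratic n (F : 'cV[R]_n -> R) (x p : 'cV[R]_n) (K : R) :
  (forall y, `|F y - F x - dotv p (y - x)| <= K * dotv (y - x) (y - x)) ->
  grad F x = p.
Proof.
move=> FK; apply/colP => i; rewrite mxE.
set e : 'cV[R]_n := delta_mx i 0.
have pe : dotv p e = p i 0.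
  rewrite /dotv (bigD1 i)//= big1 => [|j ji].
    by rewrite addr0 mxE !eqxx mulr1.
  by rewrite mxE (negbTE ji) mulr0.
have ee : dotv e e = 1.
  rewrite /dotv (bigD1 i)//= big1 => [|j ji].
    by rewrite addr0 mxE !eqxx mulr1.
  by rewrite mxE (negbTE ji) mulr0.
have hF (h : R) : h != 0 ->
    `|p i 0 - h^-1 *: (F (h *: e + x) - F x)| <= K * `|h|.
  move=> h0; have := FK (h *: e + x).
  rewrite addrK !dotv_lin pe ee mulr1 => FKh.
  have -> : p i 0 - h^-1 *: (F (h *: e + x) - F x)
      = - h^-1 * (F (h *: e + x) - F x - h * p i 0).
    move: (F (h *: e + x)) (F x) (p i 0) => a b c.
    by change (c - h^-1 * (a - b) = - h^-1 * (a - b - h * c)); field.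
  rewrite normrM normrN normfV mulrC ler_pdivrMr ?normr_gt0//.
  by rewrite -mulrA -normrM -expr2 [`|h ^+ 2|]ger0_norm ?sqr_ge0// expr2.
apply/cvg_lim => //; apply/cvgrPdist_le => eps eps0.
near=> h.
have h0 : h != 0 by near: h; exact: nbhs_dnbhs_neq.
apply: le_trans (hF h h0) _.
have K1 : 0 < `|K| + 1 by rewrite ltr_pwDr.
apply: (@le_trans _ _ ((`|K| + 1) * `|h|)).
  by rewrite ler_wpM2r// (le_trans (ler_norm K))// lerDl.
rewrite mulrC -ler_pdivlMr//.
near: h; apply: dnbhs0_le.
by rewrite divr_gt0.
Unshelve. all: by end_near. Qed.

End Descent.

(** * The proximal map and Moreau envelope of a smooth function *)

(** Column vectors are already complete and normed; this joins the two
structures, as the Banach fixed point theorem requires. *)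
HB.instance Definition _ (R : realType) (m n : nat) :=
  Complete.on 'M[R]_(m, n).

Section ForwardStep.
Set Implicit Arguments.
Unset Strict Implicit.
Context {R : realType}.

(** Banach's theorem is applied in the sup norm, for which [T] itself need not be
a contraction. Its iterate of order [N] is one when [k^N sqrt n < 1], and the
fixed point of that iterate is fixed by [T], since [T] moves it to another fixed
point of the iterate. *)
Lemma enorm_contraction_fixpoint n (T : 'cV[R]_n -> 'cV[R]_n) (k : R) :
  0 <= k < 1 -> (forall x y, enorm (T x - T y) <= k * enorm (x - y)) ->
  exists p, p = T p.
Proof.
move=> /andP[k0 k1] Tk.
have TN N x y : enorm (iter N T x - iter N T y) <= k ^+ N * enorm (x - y).
  elim: N => [|N IH]; first by rewrite expr0 mul1r.
  by rewrite !iterS exprS -mulrA (le_trans (Tk _ _))// ler_wpM2l.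
have s0 : 0 <= Num.sqrt n%:R :> R by exact: sqrtr_ge0.
have s1 : 0 < Num.sqrt n%:R + 1 :> R by rewrite ltr_wpDl.
(* The extra 1 yields at once [k^N sqrt n < 1] and [k^N < 1]. *)
have [N N1] : exists N, k ^+ N < (Num.sqrt n%:R + 1)^-1.
  have kn : `|k| < 1 by rewrite ger0_norm.
  have [N _ /(_ N (leqnn N))] :
      \forall N \near \oo, `|k ^+ N| < (Num.sqrt n%:R + 1)^-1.
    by apply: cvgr0_norm_lt (cvg_expr kn) _ _; rewrite invr_gt0.
  by rewrite /= ger0_norm ?exprn_ge0// => N1; exists N.
have kN0 : 0 <= k ^+ N by exact: exprn_ge0.
rewrite -[ltRHS]mul1r ltr_pdivlMr// in N1.
have q0 : 0 <= k ^+ N * Num.sqrt n%:R by rewrite mulr_ge0.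
have ctr : is_contraction (totalfun (iter N T)).
  exists (NngNum q0); split => [|[x y] _] /=.
    by apply: le_lt_trans N1; rewrite ler_wpM2l// lerDl.
  apply: le_trans (normr_le_enorm _) _; apply: le_trans (TN _ _ _) _.
  by rewrite -mulrA ler_wpM2l// enorm_le_normr.
have [||p _ pE] := banach_fixed_point ctr; first exact: closedT.
  by exists 0.
exists p; apply/eqP; rewrite -subr_eq0; apply/eqP/dotv_eq0.
have := TN N p (T p); rewrite -iterSr iterS.
rewrite -[iter N T p]/(totalfun (iter N T) p) -pE => h.
have k1N : k ^+ N < 1.
  by apply: le_lt_trans N1; rewrite ler_peMr// lerDr.
rewrite -sqr_enorm; have := enorm_ge0 (p - T p); nra.
Qed.

Section Prox.
Context n (g : 'cV[R]_n -> R) (Lg gamma : R).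
Hypothesis hg : lipschitz_differentiable Lg g.
Hypothesis gamma_gt0 : 0 < gamma.
Hypothesis gammaLg : gamma * Lg < 1.

Let Lg0 : 0 <= Lg. Proof. by case: hg. Qed.

(** Every [z] is reached from the fixed point of the contraction
[x |-> z - gamma grad g x]. *)
Lemma forward_step_surj (z : 'cV[R]_n) :
  exists x, z = x + gamma *: grad g x.
Proof.
have [||p pE] := @enorm_contraction_fixpoint n (fun x => z - gamma *: grad g x)
    (gamma * Lg).
- by rewrite gammaLg mulr_ge0// ltW.
- move=> x y; rewrite opprB addrC addrA subrK -scalerBr enormZ gtr0_norm//.
  rewrite -mulrA ler_pM2l//.
  by have [_ _ lg] := hg; rewrite enorm_distC.
- by exists p; rewrite {1}pE subrK.
Qed.

(** The proximal objective at [z] is minimized at [x] with quadratic growth: the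
linear terms cancel because [z - x = gamma grad g x], and the descent lemma
bounds the concavity of [g] by [Lg], which is less than [1 / gamma]. *)
Lemma prox_objective_growth (x u : 'cV[R]_n) (z := x + gamma *: grad g x) :
  g x + gamma / 2 * dotv (grad g x) (grad g x)
    + (1 - gamma * Lg) / (2 * gamma) * dotv (u - x) (u - x)
  <= g u + 1 / (2 * gamma) * enorm (u - z) ^+ 2.
Proof.
have := descent_lb x u hg; rewrite sqr_enorm.
have -> : u - z = (u - x) - gamma *: grad g x by rewrite opprD addrA.
move: (u - x) (grad g x) => d p.
rewrite !dotv_lin (dotvC d p) => h; rewrite -subr_ge0.
rewrite [leRHS](_ : _ = g u - (g x + dotv p d - Lg / 2 * dotv d d)).
  by rewrite subr_ge0.
by field; rewrite gt_eqF.
Qed.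

Lemma prox_objective_forward_step (x : 'cV[R]_n) :
  prox_objective gamma (EFin \o g) (x + gamma *: grad g x) x
  = (g x + gamma / 2 * dotv (grad g x) (grad g x))%:E.
Proof.
rewrite /prox_objective /= -EFinD opprD addNKr sqr_enorm !dotv_lin.
by congr (_ + _)%:E; field; rewrite gt_eqF.
Qed.

Lemma forward_step_minimizes (x : 'cV[R]_n) :
  prox_set gamma (EFin \o g) (x + gamma *: grad g x) = [set x].
Proof.
have gt0 : 0 < (1 - gamma * Lg) / (2 * gamma).
  by rewrite divr_gt0// ?mulr_gt0// subr_gt0.
apply/seteqP; split=> [u /(_ x)|_ -> u].
  rewrite prox_objective_forward_step lee_fin => ux.
  have := le_trans (prox_objective_growth x u) ux.
  rewrite gerDl pmulr_rle0// => /dotv_eq0/eqP.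
  by rewrite subr_eq0 => /eqP.
rewrite prox_objective_forward_step lee_fin.
apply: le_trans (prox_objective_growth x u).
by rewrite lerDl mulr_ge0 ?dotv_ge0// ltW.
Qed.

Lemma prox_g_forward_step (x : 'cV[R]_n) :
  prox_g g gamma (x + gamma *: grad g x) = x.
Proof.
by apply: xget_unique; rewrite -/(prox_set _ _ _) forward_step_minimizes.
Qed.

Lemma moreau_forward_step (x : 'cV[R]_n) :
  moreau gamma (EFin \o g) (x + gamma *: grad g x)
  = (g x + gamma / 2 * dotv (grad g x) (grad g x))%:E.
Proof.
have : prox_set gamma (EFin \o g) (x + gamma *: grad g x) x.
  by rewrite forward_step_minimizes.
rewrite -prox_objective_forward_step => xmin.
apply/eqP; rewrite eq_le; apply/andP; split.
  by apply: ereal_inf_lbound; exists x.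
by apply: le_ereal_inf_tmp => _ [u _ <-]; exact: xmin.
Qed.

Lemma moreau_g_forward_step (x : 'cV[R]_n) :
  moreau_g g gamma (x + gamma *: grad g x)
  = g x + gamma / 2 * dotv (grad g x) (grad g x).
Proof. by rewrite /moreau_g moreau_forward_step. Qed.

Lemma moreau_g_le (z u : 'cV[R]_n) :
  moreau_g g gamma z <= g u + 1 / (2 * gamma) * dotv (u - z) (u - z).
Proof.
have [x ->] := forward_step_surj z.
rewrite -lee_fin -sqr_enorm moreau_g_forward_step -moreau_forward_step.
by apply: ereal_inf_lbound; exists u.
Qed.

(** Test the infimum defining the envelope at [z'] with the minimizer [x] for
[z]. Used in both directions, this gives the upper and the lower first-order
bounds on the envelope. *)
Lemma moreau_g_increment (x z z' : 'cV[R]_n) : z = x + gamma *: grad g x ->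
  moreau_g g gamma z' - moreau_g g gamma z
  <= dotv (grad g x) (z' - z) + 1 / (2 * gamma) * dotv (z' - z) (z' - z).
Proof.
move=> zE; have := moreau_g_le z' x.
rewrite [in X in _ -> X]zE moreau_g_forward_step -zE.
have -> : x - z' = - ((z' - z) + gamma *: grad g x).
  have -> : gamma *: grad g x = z - x by rewrite zE addrC addKr.
  by rewrite addrA subrK opprB.
move: (z' - z) (grad g x) => D p.
rewrite !dotv_lin (dotvC D p) => h.
apply: le_trans (lerB h (lexx _)) _.
by rewrite le_eqVlt; apply/orP; left; apply/eqP; field; rewrite gt_eqF.
Qed.

(** The forward step is strongly monotone with modulus [1 - gamma Lg], i.e.
[(1 - gamma Lg) |d|^2 <= <d, D>] for [d = x' - x]; by Cauchy-Schwarz its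
inverse, the proximal map, is then Lipschitz with constant
[1 / (1 - gamma Lg)], whence the bound on [<d, D>]. *)
Lemma dotv_forward_step_le (x x' : 'cV[R]_n)
    (D := (x' + gamma *: grad g x') - (x + gamma *: grad g x)) :
  (1 - gamma * Lg) * dotv (x' - x) D <= dotv D D.
Proof.
have c0 : 0 < 1 - gamma * Lg by rewrite subr_gt0.
have DE : D = (x' - x) + gamma *: (grad g x' - grad g x).
  by rewrite /D scalerBr opprD addrACA.
have [_ _ /(_ x x')] := hg; rewrite (enorm_distC x) -[grad g x - _]opprB.
rewrite DE; clear D DE.
move: (x' - x) (grad g x' - grad g x) => d q lg.
have mono : (1 - gamma * Lg) * dotv d d <= dotv d (d + gamma *: q).
  have := le_trans (dotv_le_enorm d (- q)) (ler_wpM2l (enorm_ge0 d) lg).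
  rewrite mulrCA -expr2 sqr_enorm => /(ler_wpM2l (ltW gamma_gt0)).
  rewrite !dotv_lin; lra.
have := sqr_dotv_le d (d + gamma *: q).
have := dotv_ge0 (d + gamma *: q).
move: (dotv _ _) (dotv d _) (dotv d d) mono => DD t dd mono DD0 cs.
have [t0|t0] := leP t 0; first by rewrite (le_trans _ DD0)// pmulr_rle0.
rewrite -(ler_pM2r t0) -mulrA -expr2.
apply: le_trans (ler_wpM2l (ltW c0) cs) _.
by rewrite mulrA [leRHS]mulrC ler_wpM2r.
Qed.

(** The increment bound gives the upper quadratic estimate. Exchanging the two
points gives a lower one, in which [grad g x'] replaces [grad g x]; the error is
quadratic because the proximal map is Lipschitz. *)
Lemma grad_moreau_g_forward_step (x : 'cV[R]_n) :
  grad (moreau_g g gamma) (x + gamma *: grad g x) = grad g x.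
Proof.
have c0 : 0 < 1 - gamma * Lg by rewrite subr_gt0.
apply: (@grad_unique_of_quadratic _ _ _ _ _
  (1 / (2 * gamma) + 1 / (gamma * (1 - gamma * Lg)))) => z'.
have [x' z'E] := forward_step_surj z'.
set z := x + _.
have ub := moreau_g_increment z' (erefl z).
have lb := moreau_g_increment z z'E.
have := dotv_forward_step_le x x'; rewrite -z'E -/z.
have : gamma *: grad g x' = (z' - z) - (x' - x) + gamma *: grad g x.
  by rewrite z'E /z; apply/colP => i; rewrite !mxE; ring.
move: lb ub; rewrite -(opprB z' z).
move: (z' - z) (x' - x) (grad g x) (grad g x') => D d p p' lb ub pE ex.
have {}pE : gamma * dotv p' D = dotv D D - dotv d D + gamma * dotv p D.
  by rewrite -!dotvZl pE !dotv_lin.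
rewrite !dotv_lin opprK in lb.
move: ex => /= ex.
have DD0 := dotv_ge0 D.
move: (moreau_g g gamma z') (moreau_g g gamma z) ub lb => e' e ub lb.
move: (dotv D D) (dotv d D) (dotv p D) (dotv p' D) ub lb pE ex DD0.
move=> DD t pD p'D ub lb pE ex DD0.
have p'DE : p'D = pD + (DD - t) / gamma.
  rewrite -(mulKf (lt0r_neq0 gamma_gt0) p'D) pE; field.
  by rewrite gt_eqF.
have tle : t / gamma <= 1 / (gamma * (1 - gamma * Lg)) * DD.
  have -> : 1 / (gamma * (1 - gamma * Lg)) * DD = DD / (1 - gamma * Lg) / gamma.
    by field; rewrite !gt_eqF.
  by rewrite ler_pM2r ?invr_gt0// ler_pdivlMr// mulrC.
have half : 1 / (2 * gamma) * DD = DD / gamma / 2 by field; rewrite gt_eqF.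
have DDg0 : 0 <= DD / gamma by rewrite divr_ge0// ltW.
have tge : 0 <= 1 / (gamma * (1 - gamma * Lg)) * DD.
  by rewrite mulr_ge0// divr_ge0// mulr_ge0// ltW.
rewrite p'DE half in lb; rewrite half in ub.
rewrite mulrDl half ler_norml; apply/andP; split; lra.
Qed.

End Prox.
End ForwardStep.

(** * Infima, minimizers and majorizing models *)

Section ExtendedValued.
Set Implicit Arguments.
Unset Strict Implicit.
Context {R : realType}.
Local Open Scope ereal_scope.

Lemma inf_value_addl T (c : R) (phi : T -> \bar R) :
  c%:E + inf_value phi = inf_value (fun u => c%:E + phi u).
Proof.
apply/eqP; rewrite eq_le; apply/andP; split.
  apply: le_ereal_inf_tmp => _ [u _ <-].
  by rewrite leeD2l//; apply: ereal_inf_lbound; exists u.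
rewrite -leeBlDl//; apply: le_ereal_inf_tmp => _ [u _ <-].
by rewrite leeBlDl//; apply: ereal_inf_lbound; exists u.
Qed.

Lemma inf_value_comp_surj S T (E : T -> \bar R) (P : S -> T) :
  (forall x, exists z, P z = x) -> inf_value (E \o P) = inf_value E.
Proof.
move=> Psurj; congr ereal_inf; apply/seteqP; split=> _ [z _ <-].
  by exists (P z).
by have [w <-] := Psurj z; exists w.
Qed.

Lemma argmin_comp_surj S T (E : T -> \bar R) (P : S -> T) :
  (forall x, exists z, P z = x) -> P @` argmin (E \o P) = argmin E.
Proof.
move=> Psurj; apply/seteqP; split=> [_ [z zmin <-] y|x xmin].
  by have [w <-] := Psurj y; exact: zmin.
by have [z zx] := Psurj x; exists z => // w; rewrite /= zx; exact: xmin.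
Qed.

Lemma argminE T (E : T -> \bar R) (x : T) :
  argmin E x <-> E x = inf_value E.
Proof.
split=> [xmin|xE y]; last by rewrite xE; apply: ereal_inf_lbound; exists y.
apply/eqP; rewrite eq_le; apply/andP; split.
  by apply: le_ereal_inf_tmp => _ [y _ <-]; exact: xmin.
by apply: ereal_inf_lbound; exists x.
Qed.

(** A level [a < f x + G x] leaves room: some real [b] satisfies
[a - G x < b < f x], and the neighbourhood is taken where [f] stays above [b]
and [G] drops by less than [b - (a - G x)]. *)
Lemma lower_semicontinuousD n (f : 'cV[R]_n -> \bar R) (G : 'cV[R]_n -> R) :
  lower_semicontinuous f -> continuous G ->
  lower_semicontinuous (fun x => f x + (G x)%:E).
Proof.
move=> flsc Gcont x a; rewrite -lteBlDr// => afx.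
have [b [ab bfx]] : exists b : R, (a - G x < b)%R /\ b%:E < f x.
  case: (f x) afx => [r| |//].
    rewrite -EFinB lte_fin => ar; exists ((a - G x + r) / 2)%R.
    by rewrite lte_fin; split; lra.
  by move=> _; exists (a - G x + 1)%R; rewrite ltry; split=> //; lra.
have [V xV fV] := flsc x b bfx.
have e0 : (0 < b - (a - G x))%R by rewrite subr_gt0.
exists (V `&` [set y | `|G x - G y| < b - (a - G x)]%R).
  by apply: filterI => //; move/cvgrPdist_lt: (Gcont x); apply.
move=> y [/fV bfy /= Gy].
rewrite -lteBlDr//; apply: le_lt_trans bfy; rewrite -EFinB lee_fin.
have := ler_norm (G x - G y); lra.
Qed.

(** The setting of majorization-minimization: [model x] touches [phi] at [x] and
lies above it elsewhere, with a gap growing at least quadratically. *)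
Section MajorizationMinimization.
Context n (phi : 'cV[R]_n -> \bar R) (model : 'cV[R]_n -> 'cV[R]_n -> \bar R).
Context (c : R).
Hypothesis c_gt0 : (0 < c)%R.
Hypothesis model_diag : forall x, model x x = phi x.
Hypothesis model_major :
  forall x u, phi u + (c * dotv (u - x) (u - x))%:E <= model x u.

Let inf_le x : inf_value (model x) <= phi x.
Proof. by rewrite -model_diag; apply: ereal_inf_lbound; exists x. Qed.

Let phi_le_model x u : phi u <= model x u.
Proof.
apply: le_trans (model_major x u).
by rewrite leeDl// lee_fin mulr_ge0 ?dotv_ge0// ltW.
Qed.

Lemma inf_value_model :
  inf_value (fun x => inf_value (model x)) = inf_value phi.
Proof.
apply/eqP; rewrite eq_le; apply/andP; split.
  apply: le_ereal_inf_tmp => _ [x _ <-]; apply: le_trans (inf_le x).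
  by apply: ereal_inf_lbound; exists x.
apply: le_ereal_inf_tmp => _ [x _ <-].
apply: le_ereal_inf_tmp => _ [u _ <-]; apply: le_trans (phi_le_model x u).
by apply: ereal_inf_lbound; exists u.
Qed.

(** If [x] minimizes the model infimum [s] but [s < a < phi x], lower
semicontinuity keeps [phi] above [a] near [x]. A point [u] with
[model x u < s + eps] satisfies [c |u - x|^2 < eps] because [s <= phi u], so it is
near [x], while [phi u <= model x u <= a]: a contradiction. The finiteness of [s]
comes from the last two hypotheses. *)
Lemma argmin_model :
  lower_semicontinuous phi -> (exists x, phi x != +oo) ->
  (forall x, inf_value (model x) != -oo) ->
  argmin (fun x => inf_value (model x)) = argmin phi.
Proof.
move=> phi_lsc [x0 phi_x0] model_bnd; apply/seteqP; split=> x; last first.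
  move=> xmin y; apply: le_trans (inf_le x) _.
  by apply: le_ereal_inf_tmp => _ [u _ <-]; apply: le_trans (phi_le_model y u).
move=> /argminE; rewrite inf_value_model => infx.
have lb u : inf_value phi <= phi u by apply: ereal_inf_lbound; exists u.
have [s sE] : exists s : R, inf_value phi = s%:E.
  move: (model_bnd x) (lb x0); rewrite infx.
  case: (inf_value phi) => [s| |//] _; first by exists s.
  by rewrite leye_eq (negbTE phi_x0).
rewrite sE in infx lb.
suff phix : phi x <= s%:E by move=> y; exact: le_trans phix (lb y).
rewrite leNgt; apply/negP => s_lt.
have [a [sa aphi]] : exists a : R, (s < a)%R /\ a%:E < phi x.
  case: (phi x) s_lt => [r| |//].
    by rewrite lte_fin => sr; exists ((s + r) / 2)%R; rewrite lte_fin; split; lra.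
  by move=> _; exists (s + 1)%R; rewrite ltry; split=> //; lra.
have [V xV aV] := phi_lsc x a aphi.
have [r r0 rV] := nbhs_enorm_ball xV.
(* [a - s] keeps the value below [a]; [c * r] keeps [u] inside [V]. *)
pose eps := (Num.min (a - s) (c * r))%R.
have eps0 : (0 < eps)%R by rewrite lt_min subr_gt0 sa mulr_gt0.
have : inf_value (model x) < (s + eps)%:E by rewrite infx lte_fin ltrDl.
move=> /ereal_inf_lt[_ [u _ <-] ult].
have eps_as : (s + eps <= a)%R by rewrite -lerBrDl ge_min lexx.
have : V u.
  apply: rV; rewrite -(ltr_pM2l c_gt0).
  have : (s + c * dotv (u - x) (u - x))%:E < (s + eps)%:E.
    apply: le_lt_trans ult; apply: le_trans (model_major x u).
    by rewrite EFinD leeD2r.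
  by rewrite lte_fin ltrD2l => /lt_le_trans; apply; rewrite ge_min lexx orbT.
move=> /aV; apply/negP; rewrite -leNgt.
apply: le_trans (phi_le_model x u) _; apply: ltW.
by apply: lt_le_trans ult _; rewrite lee_fin.
Qed.

End MajorizationMinimization.
End ExtendedValued.

(** * The envelope as a forward-backward envelope *)

Section DavisYinEnvelope.
Set Implicit Arguments.
Unset Strict Implicit.
Context {R : realType}.

(** The strict gap below the bound gives both the contraction condition and room
for a slightly larger step. *)
Lemma step_lt_inve (l gamma : R) : 0 <= l -> 0 < gamma ->
  (gamma%:E < (l%:E)^-1)%E ->
  gamma * l < 1
  /\ exists2 gamma' : R, gamma < gamma' & (gamma'%:E < (l%:E)^-1)%E.
Proof.
move=> l0 gamma0; rewrite inver; case: ifPn => [/eqP ->|lN0].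
  by rewrite mulr0 ltr01; split => //; exists (gamma + 1); rewrite ?ltrDl ?ltry.
have {l0}lN0 : 0 < l by rewrite lt_neqAle eq_sym lN0.
rewrite lte_fin => gammal; split; first by rewrite -ltr_pdivlMr// div1r.
by exists ((gamma + l^-1) / 2); rewrite ?lte_fin; lra.
Qed.

Context (n m : nat).
Context (f : 'cV[R]_n -> \bar R) (g : 'cV[R]_n -> R) (h : 'cV[R]_m -> R).
Context (L : 'M[R]_(m, n)) (Lg Lh gamma : R).
Hypothesis gamma_gt0 : 0 < gamma.

(** The smooth part is linearized at [x], with a proximal term of step
[gamma]; [f] is kept intact. *)
Definition forward_backward_model (x u : 'cV[R]_n) : \bar R :=
  (f u + (g x + h (L *m x) + dotv (grad g x + L^T *m grad h (L *m x)) (u - x)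
     + 1 / (2 * gamma) * dotv (u - x) (u - x))%:E)%E.

Lemma forward_backward_model_diag x :
  forward_backward_model x x = objective f g h L x.
Proof.
rewrite /forward_backward_model /objective subrr dotvC !dotv0l mulr0 !addr0.
by rewrite -addeA.
Qed.

(** The bound on [f] at a step [gamma'] larger than [gamma] leaves the strictly
convex quadratic with coefficient [1/(2 gamma) - 1/(2 gamma')], which absorbs the
linear terms. *)
Lemma inf_forward_backward_model_neqNy (gamma' : R) (x : 'cV[R]_n) :
  gamma < gamma' ->
  bounded_below (fun u => (f u + (1 / (2 * gamma') * enorm u ^+ 2)%:E)%E) ->
  inf_value (forward_backward_model x) != -oo%E.
Proof.
move=> gg' [c fc].
pose a := 1 / (2 * gamma) - 1 / (2 * gamma').
have g'0 : 0 < gamma' by exact: lt_trans gg'.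
have a0 : 0 < a.
  by rewrite subr_gt0 !div1r ltf_pV2 ?posrE ?mulr_gt0// ltr_pM2l.
pose w := grad g x + L^T *m grad h (L *m x).
pose q := w - gamma^-1 *: x.
pose C := c - dotv q q / (4 * a) + g x + h (L *m x) - dotv w x
  + 1 / (2 * gamma) * dotv x x.
suff : (C%:E <= inf_value (forward_backward_model x))%E.
  by apply: contraTneq => ->; rewrite leeNy_eq.
apply: le_ereal_inf_tmp => _ [u _ <-].
have := fc u; rewrite -leeBlDr// -EFinB => fu.
rewrite /forward_backward_model -leeBlDr//; apply: le_trans fu.
rewrite -EFinB lee_fin sqr_enorm.
have qu : dotv q u = dotv w u - gamma^-1 * dotv x u.
  by rewrite dotvDl dotvNl dotvZl.
have := quadratic_lb q u a0; rewrite qu /C.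
move: (dotv q q / _) => qq.
rewrite !dotvDr !dotvDl !dotvNr !dotvNl (dotvC u x) -/w.
have -> : gamma^-1 = 2 * (1 / (2 * gamma)) by field; rewrite gt_eqF.
rewrite /a; move: (1 / (2 * gamma)) (1 / (2 * gamma')) => s s'.
move: (dotv w u) (dotv w x) (dotv x u) (dotv u u) (dotv x x) => wu wx xu uu xx.
lra.
Qed.

Hypothesis hg : lipschitz_differentiable Lg g.
Hypothesis hh : lipschitz_differentiable Lh h.

(** Descent lemma for [g] at [x] and for [h] at [L x]; the latter contributes the
modulus [Lh |L|^2], since [|L (u - x)|] is at most [|L|] times [|u - x|]. *)
Lemma forward_backward_model_major (x u : 'cV[R]_n) :
  (objective f g h L u
    + ((1 / gamma - (Lg + Lh * opnorm L ^+ 2)) / 2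
       * dotv (u - x) (u - x))%:E
   <= forward_backward_model x u)%E.
Proof.
rewrite /objective /forward_backward_model -!addeA; apply: leeD2l.
rewrite -!EFinD lee_fin.
have dg := descent_ub x u hg.
have := descent_ub (L *m x) (L *m u) hh; rewrite -mulmxBr => dh.
have LL : dotv (L *m (u - x)) (L *m (u - x))
    <= opnorm L ^+ 2 * dotv (u - x) (u - x).
  rewrite -!sqr_enorm -exprMn ler_pXn2r ?nnegrE ?enorm_ge0//.
    exact: enorm_mulmx_le.
  exact: le_trans (enorm_ge0 _) (enorm_mulmx_le _ _).
have Lh2 : 0 <= Lh / 2 by case: hh => Lh0 _ _; rewrite divr_ge0.
have {LL} := ler_wpM2l Lh2 LL.
rewrite (dotvDl (grad g x)) dotv_adjoint.
have -> : 1 / (2 * gamma) = 1 / gamma / 2 by field; rewrite gt_eqF.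
lra.
Qed.

Hypothesis gammaLg : gamma * Lg < 1.

(** With [z = x + gamma grad g x] every ingredient of the envelope is explicit in
[x], and the square inside the Moreau envelope of [f], expanded about [x],
produces the linear term of the model; the terms in [|grad g x|^2],
[<q, grad g x>] and [|q|^2] cancel. *)
Lemma envelope_prox (z : 'cV[R]_n) :
  envelope f g h L gamma z
  = inf_value (forward_backward_model (prox_g g gamma z)).
Proof.
have [x ->] := forward_step_surj hg gamma_gt0 gammaLg z.
rewrite /envelope /envelope_q (prox_g_forward_step hg)//.
rewrite (grad_moreau_g_forward_step hg)// (moreau_g_forward_step hg)//.
rewrite inf_value_addl; congr inf_value; apply/funext => u.
rewrite /prox_objective addeCA -EFinD; congr (_ + _%:E)%E.
rewrite !sqr_enorm.
have -> : u - (x + gamma *: grad g x - (2 * gamma) *: grad g x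
    - gamma *: (L^T *m grad h (L *m x)))
  = (u - x) + gamma *: (grad g x + L^T *m grad h (L *m x)).
  by apply/colP => i; rewrite !mxE; ring.
move: (u - x) (grad g x) (L^T *m _) => d a b.
rewrite !dotv_lin (dotvC d a) (dotvC d b) (dotvC b a).
by field; rewrite gt_eqF.
Qed.

End DavisYinEnvelope.

Theorem theorem5 (R : realType) (n m : nat)
    (f : 'cV[R]_n -> \bar R) (g : 'cV[R]_n -> R) (h : 'cV[R]_m -> R)
    (L : 'M[R]_(m, n)) (Lg Lh gamma : R)
    (hg : lipschitz_differentiable Lg g)
    (hh : lipschitz_differentiable Lh h)
    (f_proper : proper_fun f)
    (f_lsc : lower_semicontinuous f)
    (gamma_gt0 : 0 < gamma)
    (gamma_lt : (gamma%:E < step_bound Lg Lh L)%E)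
    (f_bnd : forall gamma' : R,
      0 < gamma' -> (gamma'%:E < step_bound Lg Lh L)%E ->
      bounded_below
        (fun x => (f x + (1 / (2 * gamma') * enorm x ^+ 2)%:E)%E)) :
  inf_value (objective f g h L) = inf_value (envelope f g h L gamma)
  /\
  argmin (objective f g h L) =
    prox_g g gamma @` argmin (envelope f g h L gamma).
Proof.
have [Lg0 dg _] := hg; have [Lh0 dh _] := hh.
have LhL0 : 0 <= Lh * opnorm L ^+ 2 by rewrite mulr_ge0 ?sqr_ge0.
have [gammal [gamma' gg' g'_lt]] :=
  step_lt_inve (addr_ge0 Lg0 LhL0) gamma_gt0 gamma_lt.
have gammaLg : gamma * Lg < 1.
  by apply: le_lt_trans gammal; rewrite ler_pM2l// lerDl.
have c_gt0 : 0 < (1 / gamma - (Lg + Lh * opnorm L ^+ 2)) / 2.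
  by rewrite divr_gt0// subr_gt0 ltr_pdivlMr// mulrC.
have prox_surj x : exists z, prox_g g gamma z = x.
  by exists (x + gamma *: grad g x); exact: prox_g_forward_step hg _ _ _.
have model_bnd x : inf_value (forward_backward_model f g h L gamma x) != -oo%E.
  apply: (inf_forward_backward_model_neqNy g h L gamma_gt0 x gg').
  by apply: f_bnd => //; exact: lt_trans gg'.
have diag := forward_backward_model_diag f g h L gamma.
have major := forward_backward_model_major f L gamma_gt0 hg hh.
have objective_lsc : lower_semicontinuous (objective f g h L).
  have -> : objective f g h L = (fun x => f x + (g x + h (L *m x))%:E)%E.
    by apply/funext => x; rewrite /objective -addeA.
  apply: lower_semicontinuousD => // x.
  apply: continuousD; first exact: differentiable_continuous.
  apply: continuous_comp; last exact: differentiable_continuous.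
  exact: mulmx_continuous.
have objective_proper : exists x, objective f g h L x != +oo%E.
  have [_ [x fx]] := f_proper; exists x; rewrite /objective -addeA.
  by case: (f x) fx.
have -> : envelope f g h L gamma
    = (fun x => inf_value (forward_backward_model f g h L gamma x))
      \o prox_g g gamma.
  by apply/funext => z; apply: (envelope_prox _ _ _ gamma_gt0 hg gammaLg).
rewrite inf_value_comp_surj// argmin_comp_surj//.
split; first by rewrite (inf_value_model c_gt0 diag major).
by rewrite (argmin_model c_gt0 diag major).
Qed.
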